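(* Let $X$ be a real Banach space with $\dim X\ge 2$. Then for all $0\le t\le \frac12$, $$C_Z^I(t)=\frac12\, Z_X(1-2t).$$
   Context: $S_X=\{x\in X:\|x\|=1\}$ is the unit sphere of $X$. Isosceles orthogonality: $x_1\perp_I x_2$ means $\|x_1+x_2\|=\|x_1-x_2\|$. For $0\le t\le \frac12$, $$C_Z^I(t)=\sup\left\{\frac{\|t x_1+(1-t)x_2\|\cdot\|(1-t)x_1+t x_2\|}{\|x_1+x_2\|^2}: x_1,x_2\in X,\ (x_1,x_2)\neq(0,0),\ x_1\perp_I x_2\right\}.$$ For $t\in[0,1]$, $$Z_X(t)=\sup\left\{\frac{\|x_1+t x_2\|\cdot\|x_1-t x_2\|}{2}: x_1,x_2\in S_X\right\}.$$ *)

(* Defs.v *)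
From HB Require Import structures.
From mathcomp Require Import all_boot all_order all_algebra.
From mathcomp Require Import all_classical all_reals all_analysis.

Set Implicit Arguments.
Unset Strict Implicit.
Unset Printing Implicit Defensive.

Import Order.TTheory GRing.Theory Num.Theory.
Import numFieldNormedType.Exports.

Local Open Scope classical_set_scope.
Local Open Scope ring_scope.

(* X may be infinite-dimensional, so a lower bound on its dimension is given
   by a linearly independent family. *)
Definition lin_indep (R : realType) (X : normedModType R) (n : nat)
    (e : 'I_n -> X) : Prop :=
  forall c : 'I_n -> R, \sum_(i < n) c i *: e i = 0 -> forall i, c i = 0.

Definition dim_ge (R : realType) (X : normedModType R) (n : nat) : Prop :=
  exists e : 'I_n -> X, lin_indep e.

Definition unit_sphere (R : realType) (X : normedModType R) : set X :=
  [set x | `|x| = 1].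
Arguments unit_sphere {R} X.

Definition isosceles_orth (R : realType) (X : normedModType R) (x1 x2 : X) :
    Prop :=
  `|x1 + x2| = `|x1 - x2|.

(* The suprema below are taken in R, where sup is 0 on sets without a least
   upper bound. For X != 0 both sets are nonempty and bounded on the parameter
   ranges in use: the quotients are at most 1 for 0 <= t <= 1/2, the products
   at most 2 for 0 <= t <= 1. The denominator `|x1 + x2| ^+ 2 is nonzero on
   the set considered: x1 + x2 = 0 and isosceles orthogonality force
   x1 = x2 = 0. *)
Definition CZI (R : realType) (X : normedModType R) (t : R) : R :=
  sup [set r : R | exists x1 x2 : X,
    [/\ (x1, x2) <> (0, 0), isosceles_orth x1 x2 &
      r = `|t *: x1 + (1 - t) *: x2| * `|(1 - t) *: x1 + t *: x2|
          / `|x1 + x2| ^+ 2]].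

Definition ZX (R : realType) (X : normedModType R) (t : R) : R :=
  sup [set r : R | exists x1 x2 : X,
    [/\ unit_sphere X x1, unit_sphere X x2 &
      r = `|x1 + t *: x2| * `|x1 - t *: x2| / 2]].

(* Main.v *)
Require Import Defs.
From HB Require Import structures.
From mathcomp Require Import all_boot all_order all_algebra.
From mathcomp Require Import all_classical all_reals all_analysis.
From mathcomp Require Import ring.
Import Order.TTheory GRing.Theory Num.Theory.
Import numFieldNormedType.Exports.
Local Open Scope ring_scope.

Lemma sup_image_mull (R : realType) (c : R) (A : set R) : 0 < c ->
  has_sup A -> sup [set c * a | a in A]%classic = c * sup A.
Proof.
move=> c0 [A0 [M AM]].
have hA : has_ubound A by exists M.
apply/eqP; rewrite eq_le; apply/andP; split.
  apply: ge_sup; first by case: A0 => a Aa; exists (c * a), a.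
  by move=> _ [a Aa <-]; rewrite ler_pM2l//; exact: ub_le_sup.
(* For the converse, the supremum of the scaled set divided by [c] bounds [A] from above. *)
rewrite mulrC -ler_pdivlMr//; apply: ge_sup => // a Aa.
rewrite ler_pdivlMr// mulrC; apply: ub_le_sup; last by exists a.
by exists (c * M) => _ [b Ab <-]; rewrite ler_pM2l//; exact: AM.
Qed.

(** Ensures that the supremum in [ZX] is a true least upper bound rather than the default value 0,
    so that a positive factor can be moved through it. *)
Lemma ZX_has_sup (R : realType) (X : normedModType R) (s : R) (x0 : X) :
  x0 != 0 -> has_sup [set r : R | exists x1 x2 : X,
    [/\ unit_sphere X x1, unit_sphere X x2 &
      r = `|x1 + s *: x2| * `|x1 - s *: x2| / 2]]%classic.
Proof.
move=> x00; split.
  have u1 : unit_sphere X (`|x0|^-1 *: x0).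
    by rewrite /unit_sphere/= normrZ normfV normr_id mulVf// normr_eq0.
  by eexists; exists (`|x0|^-1 *: x0), (`|x0|^-1 *: x0); split.
(* The triangle inequality bounds each factor by [1 + |s|]. *)
exists ((1 + `|s|) * (1 + `|s|) / 2) => _ [x [y [/= hx hy ->]]].
have hsy : `|s *: y| = `|s| by rewrite normrZ hy mulr1.
rewrite ler_pM2r ?invr_gt0 ?ltr0n//; apply: ler_pM => //.
  by rewrite (le_trans (ler_normD _ _))// hx hsy.
by rewrite (le_trans (ler_normB _ _))// hx hsy.
Qed.

Lemma dim_ge_neq0 (R : realType) (X : normedModType R) (n : nat) :
  (0 < n)%N -> dim_ge X n -> exists x : X, x != 0.
Proof.
case: n => // n _ [e he]; exists (e ord0); apply/eqP => e0.
(* If [e ord0] were zero, the coefficients 1 at [ord0] and 0 elsewhere would give a nontrivial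
   vanishing combination. *)
have /he/(_ ord0) : \sum_(i < n.+1) (i == ord0)%:R *: e i = 0.
  by apply: big1 => i _; case: eqP => [->|_]; rewrite ?e0 ?scaler0 ?scale0r.
by rewrite eqxx => /eqP; rewrite oner_eq0.
Qed.

(** The coefficients agree because [(1 - (1 - 2t)) / 2 = t] and [(1 + (1 - 2t)) / 2 = 1 - t]. *)
Lemma convex_comb_half (R : realType) (X : normedModType R) (t : R) (x y : X) :
  t *: x + (1 - t) *: y = 2^-1 *: ((x + y) - (1 - 2 * t) *: (x - y)).
Proof.
rewrite scalerBr scalerA !scalerDr scalerN opprD opprK addrACA -scalerBl -scalerDl.
by congr (_ *: _ + _ *: _); field.
Qed.

(* With u = x1 + x2 and v = x1 - x2, isosceles orthogonality reads |u| = |v|,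
   and the two factors in CZI become |u -+ (1 - 2t) v| / 2; normalizing u and v
   matches the quotients of CZI with half the products of ZX. *)
Lemma CZI_set_eq (R : realType) (X : normedModType R) (t : R) :
  [set r : R | exists x1 x2 : X,
    [/\ (x1, x2) <> (0, 0), isosceles_orth x1 x2 &
      r = `|t *: x1 + (1 - t) *: x2| * `|(1 - t) *: x1 + t *: x2|
          / `|x1 + x2| ^+ 2]]%classic =
  [set 1 / 2 * a | a in [set r : R | exists x1 x2 : X,
    [/\ unit_sphere X x1, unit_sphere X x2 &
      r = `|x1 + (1 - 2 * t) *: x2| * `|x1 - (1 - 2 * t) *: x2| / 2]]]%classic.
Proof.
have half0 : (2 : R) != 0 by rewrite pnatr_eq0.
(* Exchanging [x] and [y] in [convex_comb_half] keeps their sum and flips the sign of their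
   difference. *)
have comb x y : (1 - t) *: x + t *: y =
    2^-1 *: ((x + y) + (1 - 2 * t) *: (x - y)) :> X.
  by rewrite addrC convex_comb_half (addrC y) -(opprB x y) scalerN opprK.
have n2 : `|2^-1 : R| = 2^-1 by rewrite ger0_norm// invr_ge0 ler0n.
apply/seteqP; split => [_ [x1 [x2 [n0 orth ->]]]|_ [_ [u [v [hu hv ->]]] <-]].
  (* A zero sum forces a zero difference by orthogonality, hence [x1 = x2] and [2 x1 = 0]. *)
  have u0 : `|x1 + x2| != 0.
    apply/negP => /eqP uE; apply: n0.
    have x12 : x1 = x2.
      by apply/eqP; rewrite -subr_eq0 -normr_eq0 -orth uE.
    move: uE; rewrite x12 -mulr2n -(scaler_nat _ (_ : X)) => /eqP.
    rewrite normr_eq0 scaler_eq0 (negPf half0) /= => /eqP ->.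
    by [].
  set m := `|x1 + x2| in u0 *.
  have nm : `|m^-1| = m^-1 by rewrite normfV /m normr_id.
  exists (`|m^-1 *: (x1 + x2) + (1 - 2 * t) *: (m^-1 *: (x1 - x2))| *
     `|m^-1 *: (x1 + x2) - (1 - 2 * t) *: (m^-1 *: (x1 - x2))| / 2).
    exists (m^-1 *: (x1 + x2)), (m^-1 *: (x1 - x2)); split => //.
      by rewrite /unit_sphere/= normrZ nm mulVf.
    by rewrite /unit_sphere/= normrZ nm -orth mulVf.
  (* With [m^-1] pulled out of both norms, each side is the same product of norms over [4 m^2]. *)
  rewrite convex_comb_half comb scalerA (mulrC (1 - 2 * t)) -scalerA.
  rewrite -scalerBr -scalerDr !normrZ nm n2.
  by field.
(* These vectors have sum [u] and difference [v], inverting the change of variables. *)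
exists (2^-1 *: (u + v)), (2^-1 *: (u - v)).
have D : 2^-1 *: (u + v) + 2^-1 *: (u - v) = u.
  rewrite -scalerDr addrACA subrr addr0.
  by rewrite -mulr2n -(scaler_nat _ (_ : X)) scalerA mulVf ?scale1r.
have B : 2^-1 *: (u + v) - 2^-1 *: (u - v) = v.
  rewrite -scalerBr opprB addrC addrA subrK.
  by rewrite -mulr2n -(scaler_nat _ (_ : X)) scalerA mulVf ?scale1r.
split.
- move=> [p q]; move: D; rewrite p q addr0 => u0.
  by move/eqP: hu; rewrite -u0 normr0 eq_sym oner_eq0.
- by rewrite /isosceles_orth D B hu hv.
(* Here the denominator is [|u|^2 = 1]. *)
- rewrite convex_comb_half comb D B hu !normrZ n2.
  by field.
Qed.

Theorem theorem1 (R : realType) (X : completeNormedModType R)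
  (hX : dim_ge X 2) (t : R) (ht0 : 0 <= t) (ht1 : t <= 1 / 2) :
  CZI X t = 1 / 2 * ZX X (1 - 2 * t).
Proof.
(* A nonzero vector makes the unit sphere nonempty, as [ZX_has_sup] requires. *)
have [x x0] := @dim_ge_neq0 _ _ 2 isT hX.
by rewrite /CZI CZI_set_eq sup_image_mull//; exact: ZX_has_sup x0.
Qed.
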